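(* Let $x>0$ be irrational, let $q>0$, and let $(r_n)$ be any sequence of positive rational numbers converging to $x$. Then the measures $\mu_{r_n,q}$ converge weakly to $\mu_{x,q}$ (i.e. for every $k\ge 0$ and every filter $A$ of the induced subposet of $S_x$ on $\{0,\dots,k\}$, the $\mu_{r_n,q}$-probability that a random filter $F$ satisfies $F\cap\{0,\dots,k\}=A$ converges as $n\to\infty$ to the $\mu_{x,q}$-probability of the same event), and in particular $$[\![ r_n ]\!]_q \to [\![ x ]\!]_q .$$
   Context: Snake posets. A snake poset is a poset on $\{0,1,\dots,m\}$ (finite case) or on $\{0,1,2,\dots\}$ (infinite case) such that for each $i$ (with $i<m$ in the finite case) exactly one of $i+1\lessdot i$ or $i+1\gtrdot i$ is prescribed ($\lessdot$ = ''is covered by'', $\gtrdot$ = ''covers''), with no relations other than those implied by these. A filter of a poset is an up-closed subset. Finite snakes for rationals. $P_0$ is the empty poset, $P_1$ is the one-element poset $\{0\}$, and for $n\ge2$ with binary expansion $b_m b_{m-1}\cdots b_0$ ($b_m=1$, $n=\sum_i b_i2^i$), $P_n$ is the snake poset on $\{0,\dots,m\}$ with $i+1\gtrdot i$ if $b_i=0$ and $i+1\lessdot i$ if $b_i=1$, for $0\le i<m$. Let $\mathrm{fusc}(0)=0$, $\mathrm{fusc}(1)=1$, $\mathrm{fusc}(n)=\mathrm{fusc}(n/2)$ for even $n>1$, and $\mathrm{fusc}(n)=\mathrm{fusc}((n-1)/2)+\mathrm{fusc}((n+1)/2)$ for odd $n>1$. For rational $r>0$, $S_r:=P_n$ for the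 unique positive integer $n$ with $r=\mathrm{fusc}(n)/\mathrm{fusc}(n+1)$ (existence and uniqueness is the Stern/Calkin–Wilf theorem). $\mu_{r,q}$ is the probability measure on the filters of $S_r$ in which a filter $F$ has probability proportional to $q^{|F|}$, and $[\![ r ]\!]_q=\mu_{r,q}(0\in F)/\mu_{r,q}(0\notin F)$. Infinite snakes for irrationals. For irrational $x>0$ with continued fraction $x=[c_1;c_2,c_3,\dots]$, $c_1\ge0$, $c_i\ge1$ for $i>1$, $S_x$ is the infinite snake poset on $\{0,1,2,\dots\}$ whose steps $0\to1\to2\to\cdots$ are: $c_1$ downward steps, then $c_2$ upward steps, then $c_3$ downward steps, and so on, alternating; the step from $i$ to $i+1$ is downward if $i+1\lessdot i$ and upward if $i+1\gtrdot i$. $\mathcal{F}_x$ is the set of filters of $S_x$, a closed subset of $\{0,1\}^{\mathbb{N}}$. $\mu_{x,q}$ is the unique Borel probability measure on $\mathcal{F}_x$ such that, for every $k\ge0$ and every filter $A$ of the induced subposet of $S_x$ on $\{0,\dots,k\}$, $\mu_{x,q}(F\cap\{0,\dots,k\}=A)$ equals the limit as $\ell\to\infty$ of the probability of $F\cap\{0,\dots,k\}=A$ for a random filter $F$ (weighted proportionally to $q^{|F|}$) of a finite snake on $\{0,\dots,m\}$, $m>\ell$, agreeing with $S_x$ on the vertices $0,\dots,\ell$ (this limit exists and does not depend on the choice of continuation beyond $\ell$). Finally $[\![ x ]\!]_q=\mu_{x,q}(0\in F)/\mu_{x,q}(0\notin F)$. *)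

(* Defs.v *)
From Stdlib Require Import Relation_Operators.
From mathcomp Require Import all_boot all_order all_algebra.
From mathcomp Require Import all_classical all_reals all_analysis.
From mathcomp Require Import zify.

Set Implicit Arguments.
Unset Strict Implicit.
Unset Printing Implicit Defensive.

Import Order.TTheory GRing.Theory Num.Theory.
Import numFieldNormedType.Exports.

Local Open Scope classical_set_scope.
Local Open Scope ring_scope.

(* A snake is encoded by its steps [down : nat -> bool]: vertex [i.+1] is
   covered by [i] if [down i], and covers [i] otherwise.  Vertices live in a
   type [V] read as natural numbers through [v : V -> nat], so that the same
   order serves for the finite snakes ([V = 'I_n]) and the infinite ones
   ([V = nat]). *)
Definition snake_step (down : nat -> bool) (i j : nat) : Prop :=
  (j = i.+1 /\ ~~ down i) \/ (i = j.+1 /\ down j).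

Definition snake_le (V : Type) (v : V -> nat) (down : nat -> bool) :
    V -> V -> Prop :=
  clos_refl_trans V (fun i j => snake_step down (v i) (v j)).

Definition is_filter (V : Type) (le : V -> V -> Prop) (F : V -> bool) : Prop :=
  forall i j, le i j -> F i -> F j.

(* The snake on the vertices [0, ..., fs_size - 1]; only the values of
   [fs_down] at the [i] with [i.+1 < fs_size] are relevant. *)
Record finsnake := FinSnake { fs_size : nat; fs_down : nat -> bool }.

Definition is_fs_filter (S : finsnake) (F : {set 'I_(fs_size S)}) : Prop :=
  is_filter (snake_le (@nat_of_ord (fs_size S)) (fs_down S))
            (fun i => i \in F).

(* Sets of vertices, of finite and infinite snakes alike, are compared as
   elements of {0,1}^N. *)
Definition set_code (n : nat) (F : {set 'I_n}) : cantor_space :=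
  fun i => [exists j in F, nat_of_ord j == i].

(* The event F ∩ {0, ..., k} = A, and the event 0 ∈ F. *)
Definition cylinder (k : nat) (A : {set 'I_k.+1}) : set cantor_space :=
  [set F | forall i : 'I_k.+1, F i = (i \in A)].

Definition contains0 : set cantor_space := [set F | F 0%N].

Section FiniteMeasure.
Context {R : realType}.
Implicit Types (q : R) (S : finsnake) (E : set cantor_space).

Definition fs_weight q S E : R :=
  \sum_(F : {set 'I_(fs_size S)} | `[< is_fs_filter F /\ E (set_code F) >])
    q ^+ #|F|.

Definition fs_prob q S E : R := fs_weight q S E / fs_weight q S setT.

End FiniteMeasure.

(* [fuel] bounds the depth of the recursion. *)
Fixpoint fusc_rec (fuel n : nat) : nat :=
  if fuel is k.+1 then
    if (n <= 1)%N then n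
    else if odd n then (fusc_rec k n./2 + fusc_rec k n./2.+1)%N
    else fusc_rec k n./2
  else 0%N.

Definition fusc (n : nat) : nat := fusc_rec n n.

Lemma fusc_rec_fuel k l n : (n <= k)%N -> (n <= l)%N ->
  fusc_rec k n = fusc_rec l n.
Proof.
elim: k l n => [|k IH] [|l] n nk nl //=; try by have ->: n = 0%N by lia.
case: leqP => // n1; case: ifP => nodd; first by congr addn; apply: IH; lia.
by apply: IH; lia.
Qed.

Lemma fusc_even n : (1 < n)%N -> ~~ odd n -> fusc n = fusc n./2.
Proof.
case: n => [|n] // n1 nodd.
rewrite {1}/fusc /fusc_rec -/fusc_rec leqNgt n1 (negbTE nodd) /=.
by apply: fusc_rec_fuel; lia.
Qed.

Lemma fusc_odd n : (1 < n)%N -> odd n ->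
  fusc n = (fusc n.-1./2 + fusc n.+1./2)%N.
Proof.
case: n => [|n] // n1 nodd.
have -> : n.+1.-1./2 = n.+1./2 by lia.
have -> : n.+2./2 = n.+1./2.+1 by lia.
rewrite {1}/fusc /fusc_rec -/fusc_rec leqNgt n1 nodd.
by congr addn; apply: fusc_rec_fuel; lia.
Qed.

(* The snake P_n: its vertices are the positions of the binary digits of [n]
   (none if [n = 0]), and its [i]-th step goes down when the digit b_i is 1. *)
Definition binary_snake (n : nat) : finsnake :=
  FinSnake (if n == 0%N then 0%N else (trunc_log 2 n).+1)
           (fun i => odd (n %/ 2 ^ i)).

(* By the Stern/Calkin-Wilf theorem there is exactly one such index when
   [0 < r]. *)
Definition cw_index (r : rat) : nat :=
  get [set n : nat | (0 < n)%N /\ r = (fusc n)%:R / (fusc n.+1)%:R].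

Definition rat_snake (r : rat) : finsnake := binary_snake (cw_index r).

(* Continued fraction x = [c_1; c_2, ...] with [c_(j+1) = cf_coef x j], for
   [0 < x]. *)
Definition cf_complete {R : realType} (x : R) (j : nat) : R :=
  iter j (fun y => (y - (Num.truncn y)%:R)^-1) x.

Definition cf_coef {R : realType} (x : R) (j : nat) : nat :=
  Num.truncn (cf_complete x j).

Definition cf_sum {R : realType} (x : R) (j : nat) : nat :=
  (\sum_(l < j) cf_coef x l)%N.

(* The steps of S_x: step [i] lies in the [j]-th run of steps (counted from 0)
   when [cf_sum x j <= i < cf_sum x j.+1]; even runs go down, odd ones up. *)
Definition irr_down {R : realType} (x : R) (i : nat) : bool :=
  `[< exists j, ~~ odd j /\ (cf_sum x j <= i < cf_sum x j.+1)%N >].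

Definition inf_filters (down : nat -> bool) : set cantor_space :=
  [set F | is_filter (snake_le id down) F].

Definition is_prefix_filter (down : nat -> bool) (k : nat)
    (A : {set 'I_k.+1}) : Prop :=
  is_filter (fun i j : 'I_k.+1 => snake_le id down (i : nat) (j : nat))
            (fun i => i \in A).

Definition borel_cantor := g_sigma_algebraType (@open cantor_space).

(* [S l] is a finite snake on {0, ..., m}, m > l, agreeing with the infinite
   snake on the vertices 0, ..., l. *)
Definition approximates (S : nat -> finsnake) (down : nat -> bool) : Prop :=
  forall l, (l.+1 < fs_size (S l))%N /\
    (forall i, (i < l)%N -> fs_down (S l) i = down i).

Section InfiniteMeasure.
Context {R : realType}.
Implicit Types (x q : R) (down : nat -> bool).

(* A Borel probability measure on the closed set [inf_filters down] is seen as
   one on {0,1}^N which gives it mass 1.  Letting [S] range over all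
   approximating sequences expresses that the limit does not depend on the
   continuations chosen. *)
Definition is_snake_measure q down (mu : probability borel_cantor R) : Prop :=
  mu (inf_filters down) = 1%E /\
  forall (k : nat) (A : {set 'I_k.+1}), is_prefix_filter down A ->
  forall S : nat -> finsnake, approximates S down ->
    (fun l => fs_prob q (S l) (cylinder A)) @ \oo --> fine (mu (cylinder A)).

Definition irr_measure x q : probability borel_cantor R :=
  get [set mu | is_snake_measure q (irr_down x) mu].

Definition irr_prob x q (E : set cantor_space) : R :=
  fine (irr_measure x q E).

Definition rat_prob (r : rat) q (E : set cantor_space) : R :=
  fs_prob q (rat_snake r) E.

Definition q_rat (r : rat) q : R :=
  rat_prob r q contains0 / rat_prob r q (~` contains0).

Definition q_irr x q : R :=
  irr_prob x q contains0 / irr_prob x q (~` contains0).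

End InfiniteMeasure.

(* Main.v *)
From HB Require Import structures.
From Stdlib Require Import Relation_Operators.
Require Import Defs.
From mathcomp Require Import all_boot all_order all_algebra.
From mathcomp Require Import all_classical all_reals all_analysis.
From mathcomp Require Import zify ring lra.

Import Order.TTheory GRing.Theory Num.Theory.
Import numFieldNormedType.Exports.

(** Both sides of the convergence are governed by the same dynamical system.
    Let [farey x] be [x - 1] if [1 < x] and [x / (1 - x)] otherwise.

    - On rationals, [farey] sends [fusc n / fusc n.+1] to the value at the
      index [n./2], and the last binary digit of [n] says on which side of [1]
      the value lies ([cw_value_half]).  On irrationals, [farey] is the slow
      version of the Gauss map: a run of [cf_coef x j] subtractions followed by
      an inversion ([irr_downE]).  In both cases the [i]-th step of the snake
      goes down exactly when the [i]-th iterate of [farey] exceeds [1].  An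
      orbit of an irrational avoids [1], the only discontinuity of [farey], so
      for every [l] the snakes of [r n] eventually agree with the snake of [x]
      on the vertices [0, ..., l] ([farey_steps_near], [rat_snake_agrees]).

    - It remains to see that a long common prefix forces nearly equal
      probabilities.  Let [t] be the odds of the presence of the first vertex of
      a snake.  Prepending a step maps [t] to [q (1 + t)] for a down step and
      to [q t / (1 + t)] for an up step ([odds_S]).  Neither map increases
      relative distances.  An up step gives odds less than [q], where the down
      map shrinks relative distances at least by the factor [q / (1 + q)].  The snake of an irrational number contains the pattern
      down-up infinitely often ([farey_turning]), so the odds at a vertex [k]
      forget what lies far beyond [k] ([odds_close]).  The probability of a
      cylinder on [0, ..., k] is a ratio of two nonnegative linear forms in the
      pair of weights whose ratio is the odds at [k], so it inherits the same
      multiplicative estimate ([word_prob_close]).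

    The measure of the infinite snake has to be shown to exist.  The limits of
    the cylinder probabilities are consistent, and a consistent family of
    weights on binary words comes from a Borel probability on the Cantor space:
    the image of the uniform law on [[0, 1]] under the quantile map
    ([cantor_extension]).  That measure charges only filters, because words
    violating a step have weight [0] and are countably many.  Finally, the odds
    of the first vertex converge because the limit probability of its absence
    is positive ([limit_prob1_gt0]); this too follows from the multiplicative
    form of the estimate. *)

Set Implicit Arguments.
Unset Strict Implicit.
Unset Printing Implicit Defensive.

Local Open Scope classical_set_scope.
Local Open Scope ring_scope.

(** * Weights of the configurations of a snake *)

(** [c] tells whether the step goes down; [b] and [b'] are the memberships of
    its first and second vertices. *)
Definition step_ok (c b b' : bool) : bool := if c then b' ==> b else b ==> b'.

(** Down-up turns are the places where the memory of the far end of the snake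
    is lost. *)
Definition turning (d : nat -> bool) : Prop :=
  forall N, exists i, [/\ (N <= i)%N, d i & ~~ d i.+1].

Lemma big_tuple_cons (V : nmodType) (m : nat) (f : seq bool -> V) :
  \sum_(t : m.+1.-tuple bool) f t =
  \sum_(t : m.-tuple bool) f (true :: t) +
  \sum_(t : m.-tuple bool) f (false :: t).
Proof.
rewrite (reindex (fun p : bool * m.-tuple bool => cons_tuple p.1 p.2)) /=; last first.
  exists (fun t : m.+1.-tuple bool => (thead t, [tuple of behead t])).
    by case=> b t _; congr pair; apply: val_inj.
  by move=> t _; rewrite [RHS]tuple_eta.
by rewrite -(pair_bigA _ (fun b (t : m.-tuple bool) => f (b :: t))) big_bool.
Qed.

Lemma big_tuple0 (V : nmodType) (f : seq bool -> V) :
  \sum_(t : 0.-tuple bool) f t = f [::].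
Proof.
rewrite (bigD1 (nil_tuple bool)) //= big1 ?addr0 // => t.
by rewrite (tuple0 t).
Qed.

Section Transfer.
Context {R : realType} (q : R).
Hypothesis q_gt0 : 0 < q.

(** The contribution [q ^ #|F|] of the configuration [s] of the vertices
    [j, j + 1, ...], set to [0] when [s] is not a filter: filters are then
    summed over as unconstrained binary words. *)
Fixpoint weight (d : nat -> bool) (j : nat) (s : seq bool) : R :=
  if s is b :: s' then
    q ^+ b * (if s' is b' :: _ then step_ok (d j) b b' else true)%:R
      * weight d j.+1 s'
  else 1.

(** The partition function of the snake on [size a + m] vertices starting at
    the vertex [j], with its first vertices frozen in the configuration [a]. *)
Definition ext_weight (d : nat -> bool) (j : nat) (a : seq bool) (m : nat) : R :=
  \sum_(t : m.-tuple bool) weight d j (a ++ t).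

Lemma ext_weight_rcons d j a m :
  ext_weight d j a m.+1 = ext_weight d j (rcons a true) m + ext_weight d j (rcons a false) m.
Proof.
rewrite /ext_weight (big_tuple_cons _ (fun t => weight d j (a ++ t))).
by congr (_ + _); apply: eq_bigr => t _; rewrite cat_rcons.
Qed.

Lemma ext_weight_cons d j b b' a m : ext_weight d j [:: b, b' & a] m =
  q ^+ b * (step_ok (d j) b b')%:R * ext_weight d j.+1 (b' :: a) m.
Proof. by rewrite /ext_weight mulr_sumr. Qed.

Lemma ext_weight1_0 d j b : ext_weight d j [:: b] 0 = q ^+ b.
Proof. by rewrite /ext_weight (big_tuple0 (fun t => weight d j (_ ++ t))) /= !mulr1. Qed.

Lemma ext_weight1_S d j b m : ext_weight d j [:: b] m.+1 =
  q ^+ b * ((step_ok (d j) b true)%:R * ext_weight d j.+1 [:: true] m +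
            (step_ok (d j) b false)%:R * ext_weight d j.+1 [:: false] m).
Proof. by rewrite ext_weight_rcons /= !ext_weight_cons mulrDr !mulrA. Qed.

Lemma ext_weight1_gt0 d j b m : 0 < ext_weight d j [:: b] m.
Proof.
elim: m j b => [|m IH] j b; first by rewrite ext_weight1_0 exprn_gt0.
rewrite ext_weight1_S mulr_gt0 ?exprn_gt0 //.
have Zt := IH j.+1 true; have Zf := IH j.+1 false.
by case: (d j) b => -[]; rewrite /step_ok /= ?mul1r ?mul0r ?addr0 ?add0r ?addr_gt0.
Qed.

Lemma weight_ge0 d j s : 0 <= weight d j s.
Proof.
elim: s j => [|b s IH] j //=.
by rewrite mulr_ge0 // mulr_ge0 // exprn_ge0 // ltW.
Qed.

Lemma ext_weight_ge0 d j a m : 0 <= ext_weight d j a m.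
Proof. by apply: sumr_ge0 => t _; exact: weight_ge0. Qed.

Lemma ext_weight_nil_gt0 d j m : 0 < ext_weight d j [::] m.
Proof.
case: m => [|m]; last by rewrite ext_weight_rcons addr_gt0 //; exact: ext_weight1_gt0.
by rewrite /ext_weight (big_tuple0 (fun t => weight d j (_ ++ t))).
Qed.

(** * Contraction of the odds *)

Definition odds_step (c : bool) (t : R) : R :=
  if c then q * (1 + t) else q * (t / (1 + t)).

Fixpoint odds_iter (d : nat -> bool) (j n : nat) (t : R) : R :=
  if n is n'.+1 then odds_step (d j) (odds_iter d j.+1 n' t) else t.

Definition odds d j m : R := ext_weight d j [:: true] m / ext_weight d j [:: false] m.

Lemma odds_gt0 d j m : 0 < odds d j m.
Proof. by rewrite divr_gt0 // ext_weight1_gt0. Qed.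

Lemma odds_S d j m : odds d j m.+1 = odds_step (d j) (odds d j.+1 m).
Proof.
have Zt := ext_weight1_gt0 d j.+1 true m; have Zf := ext_weight1_gt0 d j.+1 false m.
rewrite /odds !ext_weight1_S /odds_step /step_ok.
case: (d j) => /=; rewrite !(mul1r, mul0r, addr0, add0r, expr0, expr1);
  field; rewrite ?gt_eqF ?addr_gt0 //.
Qed.

Lemma odds_addn d j n m : odds d j (n + m) = odds_iter d j n (odds d (j + n) m).
Proof.
elim: n j => [|n IH] j; first by rewrite addn0.
by rewrite addSn odds_S IH addSnnS.
Qed.

Lemma eq_odds_iter d d' j n t : (forall i, (j <= i < j + n)%N -> d i = d' i) ->
  odds_iter d j n t = odds_iter d' j n t.
Proof.
elim: n j => [|n IH] j dd' //=; rewrite dd'; last by lia.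
by rewrite IH // => i ij; apply: dd'; lia.
Qed.

Lemma odds_step_gt0 c t : 0 < t -> 0 < odds_step c t.
Proof.
move=> t0; rewrite /odds_step; case: c; rewrite mulr_gt0 ?addr_gt0 //.
by rewrite divr_gt0 ?addr_gt0.
Qed.

Lemma odds_iter_gt0 d j n t : 0 < t -> 0 < odds_iter d j n t.
Proof. by move=> t0; elim: n j => [|n IH] j //=; exact: odds_step_gt0. Qed.

(** Closeness is measured multiplicatively because the down map is expanding
    for the usual distance when [1 < q]. *)
Lemma odds_step_close c e s t : 0 <= e -> 0 < s -> s <= t <= s * (1 + e) ->
  odds_step c s <= odds_step c t <= odds_step c s * (1 + e).
Proof.
move=> e0 s0 /andP[st ts]; have t0 := lt_le_trans s0 st.
have se : 0 <= s * e by rewrite mulr_ge0 // ltW.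
rewrite /odds_step; case: c; rewrite -mulrA !ler_pM2l //; first by lra.
have s1 : 0 < 1 + s by rewrite addr_gt0.
have t1 : 0 < 1 + t by rewrite addr_gt0.
rewrite ler_pdivrMr // [t / _ * _]mulrAC ler_pdivlMr //.
rewrite ler_pdivrMr // -[s / _ * _ * _]mulrA [s / _ * _]mulrAC ler_pdivlMr //.
have set_ge0 : 0 <= s * e * t by rewrite mulr_ge0 // ltW.
apply/andP; split; nra.
Qed.

Lemma odds_step_up_lt t : 0 < t -> odds_step false t < q.
Proof.
move=> t0; rewrite /odds_step -[ltRHS]mulr1 ltr_pM2l //.
by rewrite ltr_pdivrMr ?addr_gt0 // mul1r ltrDr.
Qed.

(** Since [(1 + t) / (1 + s) - 1 = (t / s - 1) * (s / (1 + s))], the down map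
    contracts relative distances by the factor [s / (1 + s)], uniformly below
    [1] as long as [s] is bounded. *)
Lemma odds_step_down_contract e s t : 0 <= e -> 0 < s -> s <= q ->
  s <= t <= s * (1 + e) ->
  odds_step true t <= odds_step true s * (1 + e * (q / (1 + q))).
Proof.
move=> e0 s0 sq /andP[st ts]; rewrite /odds_step -mulrA ler_pM2l //.
have q1 : 0 < 1 + q by rewrite addr_gt0.
have rE : q / (1 + q) * (1 + q) = q by rewrite divfK // gt_eqF.
have r0 : 0 <= q / (1 + q) by rewrite divr_ge0 // ltW.
set r := q / (1 + q) in rE r0 *.
(* [s <= r (1 + s)] because [s / (1 + s)] increases with [s] *)
have sr : s <= r * (1 + s).
  rewrite /r mulrAC ler_pdivlMr //; nra.
have := ler_wpM2l e0 sr.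
nra.
Qed.

Lemma odds_iter_close d j n e s t : 0 <= e -> 0 < s -> s <= t <= s * (1 + e) ->
  odds_iter d j n s <= odds_iter d j n t <= odds_iter d j n s * (1 + e).
Proof.
move=> e0 s0 st; elim: n j => [|n IH] j //=.
by apply: odds_step_close => //; exact: odds_iter_gt0.
Qed.

Lemma odds_iter_add d j m n t :
  odds_iter d j (m + n) t = odds_iter d j m (odds_iter d (j + m) n t).
Proof.
elim: m j => [|m IH] j /=; first by rewrite addn0.
by rewrite IH addSnnS.
Qed.

Lemma odds_iter_le d j n s t : 0 < s -> s <= t ->
  odds_iter d j n s <= odds_iter d j n t.
Proof.
move=> s0 st.
have := @odds_iter_close d j n ((t - s) / s) s t.
rewrite divr_ge0 ?subr_ge0 ?(ltW s0) // => /(_ isT s0).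
have -> : s * (1 + (t - s) / s) = t by field; rewrite gt_eqF.
by rewrite st lexx => /(_ isT) /andP[].
Qed.

(** The innermost down-up turn maps all positive odds into [[q, q (1 + q)]],
    which gives the initial relative distance [q] without any bound on [s] and
    [t]; each further turn gains a factor [q / (1 + q)].  The condition [0 < n]
    is there for the induction: it makes the up step of the turn at [i] the last
    one to have been applied before the down step. *)
Lemma odds_iter_contract d c j : turning d ->
  exists n, (0 < n)%N /\ forall s t, 0 < s -> s <= t ->
    odds_iter d j n t <=
      odds_iter d j n s * (1 + q * (q / (1 + q)) ^+ c).
Proof.
move=> turn; elim: c j => [|c IH] j.
  have [i [ji di di1]] := turn j.
  exists ((i - j) + 2)%N; split; first by lia.
  move=> s t s0 st; rewrite !odds_iter_add (subnKC ji).
  rewrite expr0 mulr1.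
  have := @odds_iter_close d j (i - j) q (odds_iter d i 2 s) (odds_iter d i 2 t)
            (ltW q_gt0) (odds_iter_gt0 d i 2 s0).
  move=> /(_ _)/andP[|] //.
  rewrite odds_iter_le //= di (negbTE di1).
  have t0 := lt_le_trans s0 st.
  have tq := odds_step_up_lt t0; have sq := odds_step_gt0 false s0.
  have tp := odds_step_gt0 false t0.
  rewrite [odds_step true _]/odds_step [X in _ <= X * _]/odds_step -mulrA ler_pM2l //.
  nra.
have [i [ji di di1]] := turn j.
have [n [n0 Hn]] := IH i.+1.
exists ((i - j) + n.+1)%N; split; first by lia.
move=> s t s0 st; rewrite !odds_iter_add (subnKC ji).
set e := q * _.
have e0 : 0 <= e by rewrite mulr_ge0 ?exprn_ge0 ?divr_ge0 ?addr_ge0 ?(ltW q_gt0).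
have close : odds_iter d i n.+1 s <= odds_iter d i n.+1 t
               <= odds_iter d i n.+1 s * (1 + e).
  rewrite odds_iter_le //=  di /e exprSr mulrA.
  apply: odds_step_down_contract.
  - by rewrite mulr_ge0 ?exprn_ge0 ?divr_ge0 ?addr_ge0 ?(ltW q_gt0).
  - exact: odds_iter_gt0.
  - case: n n0 {Hn} => // n _ /=; rewrite (negbTE di1).
    by apply/ltW/odds_step_up_lt/odds_iter_gt0.
  - by rewrite odds_iter_le //= Hn.
have := @odds_iter_close d j (i - j) e _ _ e0 (odds_iter_gt0 d i n.+1 s0) close.
by case/andP.
Qed.

(** * Probabilities of words are insensitive to the far end of the snake *)

Lemma odds_close d k e : turning d -> 0 < e ->
  exists n, forall d' d'' m m', (n <= m)%N -> (n <= m')%N ->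
    (forall i, (i < k + n)%N -> d' i = d i) ->
    (forall i, (i < k + n)%N -> d'' i = d i) ->
    odds d' k m <= (1 + e) * odds d'' k m'.
Proof.
move=> turn e0; have q1 : 0 < 1 + q by rewrite addr_gt0.
have r0 : 0 <= q / (1 + q) by rewrite divr_ge0 // ltW.
have [c Hc] : exists c, q * (q / (1 + q)) ^+ c <= e.
  have r1 : `|q / (1 + q)| < 1.
    by rewrite ger0_norm // ltr_pdivrMr // mul1r ltrDr.
  have /cvgrPdist_le /(_ (e / q)) := cvg_expr r1.
  rewrite divr_gt0 // => /(_ isT)[c _ /(_ c)]/(_ (leqnn _)) /=.
  rewrite sub0r normrN ger0_norm ?exprn_ge0 // => H; exists c.
  by rewrite mulrC -ler_pdivlMr.
have [n [_ Hn]] := odds_iter_contract c k turn.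
exists n => d' d'' m m' nm nm' dd' dd''.
rewrite -(subnKC nm) -(subnKC nm') !odds_addn.
rewrite !(@eq_odds_iter _ d) => [|i ?|i ?]; last 2 first.
- by apply: dd''; lia.
- by apply: dd'; lia.
set t := odds _ _ _; set s := odds d'' _ _.
have t0 : 0 < t := odds_gt0 _ _ _; have s0 : 0 < s := odds_gt0 _ _ _.
have [st|/ltW ts] := leP s t.
  rewrite mulrC; apply: (le_trans (Hn _ _ s0 st)).
  by rewrite ler_pM2l ?odds_iter_gt0 // lerD2l.
apply: (le_trans (odds_iter_le _ _ _ t0 ts)).
by rewrite ler_peMl ?lerDl ?ltW // odds_iter_gt0.
Qed.

(** The weights of the words ending at the vertex [k], as well as the total
    weights, are nonnegative combinations of the two weights at [k].
    Cross-multiplied inequalities between two pairs of weights extend to such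
    combinations, by adding one vertex in front at a time. *)
Lemma ext_weight_close d d' k m m' e : 0 <= e -> (forall i, (i < k)%N -> d i = d' i) ->
  odds d k m <= (1 + e) * odds d' k m' ->
  odds d' k m' <= (1 + e) * odds d k m ->
  forall j b0 a c, (j + size a)%N = k ->
    ext_weight d j (b0 :: a) m * ext_weight d' j [:: c] (size a + m') <=
    (1 + e) * (ext_weight d' j (b0 :: a) m' * ext_weight d j [:: c] (size a + m)).
Proof.
move=> e0 dd' tt' t't j b0 a; elim: a j b0 => [|b1 a IH] j b0 c /=.
  rewrite addn0 => ->; rewrite !add0n.
  have Zt := ext_weight1_gt0 d k true m; have Zf := ext_weight1_gt0 d k false m.
  have Zt' := ext_weight1_gt0 d' k true m'; have Zf' := ext_weight1_gt0 d' k false m'.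
  move: tt' t't; rewrite /odds !mulrA.
  rewrite !ler_pdivrMr // mulrAC ler_pdivlMr // => H1.
  rewrite mulrAC ler_pdivlMr // => H2.
  have et := mulr_ge0 e0 (mulr_ge0 (ltW Zt) (ltW Zt')).
  have ef := mulr_ge0 e0 (mulr_ge0 (ltW Zf) (ltW Zf')).
  by case: b0 c => -[]; lra.
move=> jk; rewrite !ext_weight_cons addSn !ext_weight1_S (dd' j); last by lia.
set x := q ^+ b0 * _; have x0 : 0 <= x.
  by rewrite mulr_ge0 // exprn_ge0 // ltW.
have y0 : 0 <= q ^+ c by rewrite exprn_ge0 // ltW.
have IHt := IH j.+1 b1 true; have IHf := IH j.+1 b1 false.
move: IHt IHf; rewrite addSnnS => /(_ jk) IHt /(_ jk) IHf.
set u := (step_ok _ c true)%:R; set v := (step_ok _ c false)%:R.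
have u0 : 0 <= u by []. have v0 : 0 <= v by [].
have := ler_wpM2l u0 IHt; have := ler_wpM2l v0 IHf.
set A := ext_weight _ _ _ _; set B := ext_weight _ _ _ _; set C := ext_weight _ _ _ _.
move=> H1 H2.
have {H1 H2} H := lerD H2 H1.
have := ler_wpM2l (mulr_ge0 x0 y0) H.
rewrite !(mulrDr, mulrDl) => {}H; lra.
Qed.

(** Truncated subtraction: meaningful only for [size a <= n]. *)
Definition word_prob d n (a : seq bool) : R :=
  ext_weight d 0 a (n - size a) / ext_weight d 0 [::] n.

Lemma word_prob_ge0 d n a : 0 <= word_prob d n a.
Proof. by rewrite divr_ge0 // ?ext_weight_ge0 // ltW // ext_weight_nil_gt0. Qed.

Lemma word_prob_nil d n : word_prob d n [::] = 1.
Proof. by rewrite /word_prob subn0 divff // gt_eqF // ext_weight_nil_gt0. Qed.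

Lemma word_prob_rcons d n a : (size a < n)%N ->
  word_prob d n a = word_prob d n (rcons a true) + word_prob d n (rcons a false).
Proof.
move=> an; rewrite /word_prob !size_rcons -mulrDl.
by rewrite -ext_weight_rcons; congr (ext_weight _ _ _ _ / _); lia.
Qed.

Lemma word_prob_le1 d n a : (size a <= n)%N -> word_prob d n a <= 1.
Proof.
elim/last_ind: a => [|a b IH]; first by rewrite word_prob_nil.
rewrite size_rcons => an; apply: le_trans (IH (ltnW an)).
rewrite (word_prob_rcons d an).
by case: b; rewrite ?lerDl ?lerDr word_prob_ge0.
Qed.

Lemma word_prob1_gt0 d n b : 0 < word_prob d n [:: b].
Proof. by rewrite divr_gt0 ?ext_weight1_gt0 ?ext_weight_nil_gt0. Qed.

(** The multiplicative form gives both the existence of the limits and their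
    positivity. *)
Lemma word_prob_close d k e : turning d -> 0 < e ->
  exists l, forall d' d'' n n' a, (l < n)%N -> (l < n')%N ->
    (forall i, (i < l)%N -> d' i = d i) ->
    (forall i, (i < l)%N -> d'' i = d i) ->
    size a = k.+1 -> word_prob d' n a <= (1 + e) * word_prob d'' n' a.
Proof.
move=> turn e0; have [N HN] := odds_close k turn e0.
exists (k + N)%N => d' d'' n n' [//|b a] ln ln' dd' dd'' [ak].
have [nE nE'] : n = (k + (n - k.+1)).+1 /\ n' = (k + (n' - k.+1)).+1 by lia.
rewrite /word_prob /= ak.
have Hm : (N <= n - k.+1)%N by lia.
have Hm' : (N <= n' - k.+1)%N by lia.
have H1 := HN _ _ _ _ Hm Hm' dd' dd''; have H2 := HN _ _ _ _ Hm' Hm dd'' dd'.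
have d'E i : (i < k)%N -> d' i = d'' i by move=> ik; rewrite dd' ?dd'' //; lia.
have := ext_weight_close (ltW e0) d'E H1 H2 b; move=> /(_ 0%N a) H.
have := lerD (H true ak) (H false ak).
rewrite -mulrDr -mulrDr -mulrDr ak -!(ext_weight_rcons _ _ [::]) -nE -nE' => {}H.
rewrite mulrA ler_pdivrMr ?ext_weight_nil_gt0 // mulrAC ler_pdivlMr ?ext_weight_nil_gt0 //.
by rewrite (le_trans H) // mulrA mulrAC.
Qed.

End Transfer.

(** * Finite snakes as binary words *)

Definition steps_ok (d : nat -> bool) (j : nat) (s : seq bool) : Prop :=
  forall i, (i.+1 < size s)%N ->
    step_ok (d (j + i)%N) (nth false s i) (nth false s i.+1).

Lemma steps_ok_cons d j b b' s : steps_ok d j [:: b, b' & s] <->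
  step_ok (d j) b b' /\ steps_ok d j.+1 (b' :: s).
Proof.
split=> [H|[H0 H] [|i] isz].
- by split=> [|i isz]; [have := H 0%N|have := H i.+1]; rewrite ?addn0 ?addSnnS; apply.
- by rewrite addn0.
- by rewrite -addSnnS; apply: H.
Qed.

Definition word (k : nat) (A : {set 'I_k}) : seq bool :=
  [seq i \in A | i <- enum 'I_k].

Lemma size_word k (A : {set 'I_k}) : size (word A) = k.
Proof. by rewrite size_map size_enum_ord. Qed.

Lemma nth_word k (A : {set 'I_k}) (i : 'I_k) : nth false (word A) i = (i \in A).
Proof. by rewrite (nth_map i) ?size_enum_ord // nth_ord_enum. Qed.

Lemma set_codeE n (F : {set 'I_n}) : set_code F = nth false (word F).
Proof.
apply/funext => i; rewrite /set_code; have [ilt|ige] := ltnP i n.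
  rewrite -[i in RHS]/(nat_of_ord (Ordinal ilt)) nth_word.
  apply/existsP/idP => [[j /andP[jF /eqP ji]]|iF]; last by exists (Ordinal ilt); rewrite iF /=.
  by rewrite (_ : Ordinal ilt = j) //; apply: val_inj.
rewrite nth_default ?size_word //; apply/existsP => -[j /andP[_ /eqP ji]].
by have := ltn_ord j; rewrite ji ltnNge ige.
Qed.

Lemma fs_filterP (S : finsnake) (F : {set 'I_(fs_size S)}) :
  is_fs_filter F <-> steps_ok (fs_down S) 0 (word F).
Proof.
rewrite /steps_ok size_word; split=> [filF i ilt|H].
  pose i0 := Ordinal (ltnW ilt); pose i1 := Ordinal ilt.
  rewrite -[i in nth _ _ i]/(val i0) -[i.+1]/(val i1) !nth_word add0n /step_ok.
  case: ifP => di; apply/implyP; apply: filF; apply: rt_step; rewrite /snake_step /=.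
    by right.
  by left; rewrite di.
move=> i j; elim=> {i j} [i j|//|i j l _ IH1 _ IH2]; last by move=> /IH1.
case=> -[ij di].
- have := H i; rewrite -ij => /(_ (ltn_ord j)).
  by rewrite ij -{1}ij !nth_word add0n /step_ok (negbTE di) => /implyP.
- have := H j; rewrite -ij => /(_ (ltn_ord i)).
  by rewrite !nth_word add0n /step_ok di => /implyP.
Qed.

Lemma big_tuple_prefix (V : nmodType) (n : nat) (a : seq bool) (f : seq bool -> V) :
  (size a <= n)%N ->
  \sum_(t : n.-tuple bool | take (size a) t == a) f t =
  \sum_(t : (n - size a).-tuple bool) f (a ++ t).
Proof.
elim: a n f => [|b a IH] n f /= an.
  by rewrite subn0; apply: eq_bigl => t; rewrite take0 eqxx.
case: n an => // n an; rewrite subSS -(IH n (fun s => f (b :: s))) //.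
rewrite [LHS]big_mkcond.
rewrite (big_tuple_cons _ (fun t => if take (size a).+1 t == b :: a then f t else 0)).
rewrite [RHS]big_mkcond /=; case: b => /=.
  by rewrite [X in _ + X]big1 ?addr0 //.
by rewrite big1 ?add0r //.
Qed.

Section FiniteSnakes.
Context {R : realType}.
Variable q : R.

Lemma weightE d j s :
  weight q d j s = if `[< steps_ok d j s >] then q ^+ count id s else 0.
Proof.
elim: s j => [|b [|b' s] IH] j.
- by rewrite asboolT //.
- by rewrite asboolT //= addn0 !mulr1.
rewrite [LHS]/= -/(weight q d j.+1 (b' :: s)) IH (asbool_equiv_eq (steps_ok_cons _ _ _ _ _)).
rewrite asbool_and asboolb; case: step_ok => /=; last by rewrite mulr0 mul0r.
by rewrite mulr1; case: ifP => _; rewrite ?mulr0 // -exprD.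
Qed.

Lemma fs_weightE (S : finsnake) (E : set cantor_space) :
  fs_weight q S E =
  \sum_(t : (fs_size S).-tuple bool | `[< E (nth false t) >])
    weight q (fs_down S) 0 t.
Proof.
pose h (t : (fs_size S).-tuple bool) := [set i | tnth t i]%SET.
have hK t : word (h t) = t.
  apply: (@eq_from_nth _ false); rewrite ?size_word ?size_tuple // => i ilt.
  by rewrite -[i]/(val (Ordinal ilt)) nth_word inE (tnth_nth false).
rewrite /fs_weight (reindex h) /=; last first.
  exists (fun F : {set 'I_(fs_size S)} => [tuple i \in F | i < fs_size S]).
    by move=> t _; apply: eq_from_tnth => i; rewrite tnth_mktuple inE.
  by move=> F _; apply/setP => i; rewrite inE tnth_mktuple.
rewrite big_mkcond [RHS]big_mkcond; apply: eq_bigr => t _.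
rewrite asbool_and (asbool_equiv_eq (fs_filterP _)) set_codeE hK weightE.
case: asbool; case: asbool => //=; congr (q ^+ _).
rewrite -[in RHS](hK t) /word count_map cardE {1}/enum_mem size_filter -enumT.
exact: eq_count.
Qed.

Lemma fs_probE (S : finsnake) k (A : {set 'I_k.+1}) : (k < fs_size S)%N ->
  fs_prob q S (cylinder A) = word_prob q (fs_down S) (fs_size S) (word A).
Proof.
move=> kS; rewrite /fs_prob /word_prob !fs_weightE; congr (_ / _); last first.
  by apply: eq_bigl => t; rewrite asboolT.
rewrite /ext_weight -[RHS]big_tuple_prefix ?size_word //; apply: eq_bigl => t.
apply/asboolP/eqP => [/= Et|tA i]; last first.
  by rewrite -nth_word -tA nth_take.
have size_tk : size (take k.+1 t) = k.+1 by rewrite size_takel // size_tuple.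
apply: (@eq_from_nth _ false); rewrite size_tk ?size_word // => i ik.
by rewrite nth_take // -[i]/(val (Ordinal ik)) Et nth_word.
Qed.

End FiniteSnakes.

(** * Borel probabilities on the Cantor space with prescribed cylinder masses *)

Definition word_cylinder (a : seq bool) : set cantor_space :=
  [set F | mkseq F (size a) = a].

Lemma word_cylinder_nil : word_cylinder [::] = setT.
Proof. by apply/seteqP; split. Qed.

Lemma word_cylinder_rcons a b : word_cylinder (rcons a b) =
  word_cylinder a `&` [set F : cantor_space | F (size a) = b].
Proof.
apply/seteqP; split => F; rewrite /word_cylinder /= size_rcons mkseqS.
  by move/rcons_inj => [-> ->].
by move=> [-> ->].
Qed.

Lemma coordinate_open i b : open [set F : cantor_space | F i = b].
Proof.
have pc : continuous (fun F : cantor_space => F i) :=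
  @proj_continuous nat (fun=> bool) i.
exact: ((@continuousP cantor_space bool _).1 pc _ (discrete_open [set b])).
Qed.

Lemma word_cylinder_open a : open (word_cylinder a).
Proof.
elim/last_ind: a => [|a b IH]; first by rewrite word_cylinder_nil; exact: openT.
by rewrite word_cylinder_rcons; apply: openI => //; exact: coordinate_open.
Qed.

(** Otherwise points outside [U] sharing longer and longer prefixes with [F]
    would converge to [F] pointwise, hence in the product topology. *)
Lemma open_word_cylinder (U : set cantor_space) (F : cantor_space) :
  open U -> U F -> exists n, word_cylinder (mkseq F n) `<=` U.
Proof.
move=> oU UF; apply: contrapT => /forallNP H.
have {}H n : exists G : cantor_space, word_cylinder (mkseq F n) G /\ ~ U G.
  by have /existsNP[G /not_implyP GP] := H n; exists G.
pose G n := sval (cid (H n)).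
have GP n : word_cylinder (mkseq F n) (G n) /\ ~ U (G n) := svalP (cid (H n)).
have GF : G @ \oo --> F.
  apply/cvg_sup => i W [/= _ [[V oV <-] /= VF]] /filterS; apply.
  exists i.+1 => // n /= ni.
  have [/(congr1 (nth false ^~ i)) + _] := GP n.
  by rewrite size_mkseq !nth_mkseq //= => ->.
have /GF [N _ /(_ N)/=] : nbhs F U by apply: open_nbhs_nbhs.
by move=> /(_ (leqnn N)); case: (GP N).
Qed.

Lemma open_bigcup_word_cylinder (U : set cantor_space) : open U ->
  U = \bigcup_(a : seq bool)
        (if `[< word_cylinder a `<=` U >] then word_cylinder a else set0).
Proof.
move=> oU; apply/seteqP; split => [F UF|F [a _]].
  have [n nU] := open_word_cylinder oU UF.
  by exists (mkseq F n) => //; rewrite asboolT // /word_cylinder /= size_mkseq.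
by case: ifP => // /asboolP; apply.
Qed.

Lemma measurable_word_cylinder a : measurable (word_cylinder a : set borel_cantor).
Proof. by apply: sub_gen_smallest; exact: word_cylinder_open. Qed.

Section Extension.
Context {R : realType}.
Variable p : seq bool -> R.
Hypothesis p_ge0 : forall a, 0 <= p a.
Hypothesis p_nil : p [::] = 1.
Hypothesis p_rcons : forall a, p a = p (rcons a true) + p (rcons a false).

(** Words of a given size, ordered lexicographically, tile [[0, 1]] by intervals
    of lengths [p a]; [lower a] is the left end of the interval of [a], and
    [threshold a] separates the intervals of its two extensions. *)
Definition lower (a : seq bool) : R :=
  \sum_(i < size a) (nth false a i)%:R * p (rcons (take i a) false).

Definition threshold (a : seq bool) : R := lower a + p (rcons a false).

Lemma lower_nil : lower [::] = 0.
Proof. exact: big_ord0. Qed.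

Lemma lower_rcons a b : lower (rcons a b) =
  lower a + b%:R * p (rcons a false).
Proof.
rewrite /lower size_rcons big_ord_recr /=.
rewrite nth_rcons ltnn eqxx -cats1 take_size_cat //.
congr (_ + _); apply: eq_bigr => i _.
by rewrite nth_cat ltn_ord takel_cat // ltnW.
Qed.

Lemma lower_bounds a : 0 <= lower a /\ lower a + p a <= 1.
Proof.
elim/last_ind: a => [|a b [l0 l1]]; first by rewrite lower_nil p_nil add0r.
have pf := p_ge0 (rcons a false); have pt := p_ge0 (rcons a true).
move: l1; rewrite lower_rcons p_rcons.
by case: b; rewrite /= ?mul1r ?mul0r ?addr0 => l1; split; lra.
Qed.

Fixpoint quantile_prefix (u : R) (n : nat) : seq bool :=
  if n is n'.+1 then
    let a := quantile_prefix u n' in rcons a (threshold a <= u)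
  else [::].

Definition quantile (u : measurableTypeR R) : borel_cantor :=
  fun i => threshold (quantile_prefix u i) <= u.

Lemma quantile_mkseq u n : mkseq (quantile u) n = quantile_prefix u n.
Proof. by elim: n => // n IH; rewrite mkseqS IH. Qed.

Lemma quantile_preimage_rcons a b :
  quantile @^-1` word_cylinder (rcons a b) =
  quantile @^-1` word_cylinder a `&` [set u | (threshold a <= u) = b].
Proof.
rewrite word_cylinder_rcons preimage_setI.
apply/seteqP; split=> u [ua]; have := ua;
  rewrite /word_cylinder /= quantile_mkseq => uaE; rewrite /quantile uaE;
  by split.
Qed.

Lemma measurable_quantile_preimage a :
  measurable (quantile @^-1` word_cylinder a).
Proof.
elim/last_ind: a => [|a b IH]; first by rewrite word_cylinder_nil preimage_setT.
rewrite quantile_preimage_rcons; apply: measurableI => //.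
case: b.
  rewrite (_ : [set u | _] = `[threshold a, +oo[%classic) //.
  by apply/seteqP; split=> u /=; rewrite in_itv /= andbT.
rewrite (_ : [set u | _] = `]-oo, threshold a[%classic) //.
by apply/seteqP; split=> u /=; rewrite in_itv /= ltNge; case: (_ <= _).
Qed.

Lemma measurable_quantile : measurable_fun setT quantile.
Proof.
apply: (@measurability _ _ _ borel_cantor _ _ (@open cantor_space)) => // _ [U oU <-].
rewrite setTI (open_bigcup_word_cylinder oU) preimage_bigcup.
apply: countable_bigcupT_measurable; first exact: countableP.
move=> a; case: ifP => _; last by rewrite preimage_set0.
exact: measurable_quantile_preimage.
Qed.

Lemma quantile_itv a :
  `[lower a, lower a + p a[ `<=` quantile @^-1` word_cylinder a.
Proof.
elim/last_ind: a => [|a b IH] u; first by rewrite word_cylinder_nil.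
have pf := p_ge0 (rcons a false); have pt := p_ge0 (rcons a true).
rewrite quantile_preimage_rcons /= in_itv /= lower_rcons => /andP[lu ul].
split.
  apply: IH; rewrite /= in_itv /= p_rcons.
  by case: b lu ul; rewrite /= ?mul1r ?mul0r ?addr0 => lu ul; apply/andP; split; lra.
rewrite /= /threshold; case: b lu ul; rewrite /= ?mul1r ?mul0r ?addr0 => lu ul //.
by apply/negbTE; rewrite -ltNge.
Qed.

Lemma uniform_prob_itvco (x y : R) : 0 <= x -> x <= y -> y <= 1 ->
  uniform_prob (@ltr01 R) `[x, y[ = (y - x)%:E.
Proof.
move=> x0 xy y1; rewrite /uniform_prob.
rewrite (eq_integral (fun=> 1%E)); last first.
  move=> u; rewrite inE /= in_itv /= => /andP[xu uy]; rewrite /uniform_pdf subr0 invr1.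
  by rewrite (le_trans x0 xu) (le_trans (ltW uy) y1).
rewrite integral_cst //= mul1e lebesgue_measure_itv /= lte_fin.
by case: ltgtP xy => // -> _; rewrite subrr.
Qed.

HB.instance Definition _ :=
  isMeasurableFun.Build _ _ _ _ quantile measurable_quantile.

(** The image of the uniform law under the quantile map gives to the cylinder of
    [a] at least the length [p a] of its interval.  Equality follows by
    induction without examining the end points: the masses of the two
    extensions of [a] have the same sum as their lower bounds. *)
Theorem cantor_extension : exists mu : probability borel_cantor R,
  forall a, mu (word_cylinder a) = (p a)%:E.
Proof.
pose mu : probability borel_cantor R :=
  distribution (uniform_prob (@ltr01 R)) quantile.
exists mu.
have ge a : ((p a)%:E <= mu (word_cylinder a))%E.
  have [l0 l1] := lower_bounds a.
  rewrite -[p a](addKr (lower a)) addrC -uniform_prob_itvco //; last by rewrite lerDl.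
  apply: le_measure; rewrite ?inE //; first exact: measurable_quantile_preimage.
  exact: quantile_itv.
elim/last_ind => [|a b IH].
  by rewrite word_cylinder_nil p_nil; exact: probability_setT.
have split_a : mu (word_cylinder a) =
    (mu (word_cylinder (rcons a true)) + mu (word_cylinder (rcons a false)))%E.
  rewrite -measureU.
  - congr (mu _); rewrite !word_cylinder_rcons -setIUr; apply/seteqP.
    by split=> [F Fa|F []//]; split=> //=; case: (F _); [left|right].
  - exact: measurable_word_cylinder.
  - exact: measurable_word_cylinder.
  - rewrite !word_cylinder_rcons; apply/seteqP; split=> // F [[_ /= ->]] [_ /=].
    by [].
move: split_a; rewrite IH p_rcons EFinD => /esym E.
have ft := ge (rcons a true); have ff := ge (rcons a false).
move: E ft ff; case: b;
  case: (mu (word_cylinder (rcons a true))) => [x| |];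
  case: (mu (word_cylinder (rcons a false))) => [y| |] //;
  rewrite -!EFinD !lee_fin => -[E] ft ff; congr (_%:E); lra.
Qed.

End Extension.

(** * The slow continued fraction map *)

Section Farey.
Context {R : realType}.
Implicit Types x y : R.

Definition farey x : R := if 1 < x then x - 1 else x / (1 - x).

Lemma irrational_neq x (s : rat) : irrational x -> x != ratr s.
Proof. by move=> irr; apply/eqP => xs; apply: irr; exists s. Qed.

Lemma irrational_neq_nat x n : irrational x -> x != n%:R.
Proof. by move=> irr; rewrite -(ratr_nat R); exact: irrational_neq. Qed.

Lemma irrational_subn x n : irrational x -> irrational (x - n%:R).
Proof.
move=> irr -[s _ sx]; apply: irr; exists (s + n%:R) => //.
by rewrite rmorphD /= ratr_nat sx subrK.
Qed.

Lemma irrational_inv x : irrational x -> irrational x^-1.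
Proof.
move=> irr -[s _ sx]; apply: irr; exists s^-1 => //.
by rewrite fmorphV /= sx invrK.
Qed.

Lemma farey_down x : 1 < x -> farey x = x - 1.
Proof. by rewrite /farey => ->. Qed.

(** Below [1] the map is the conjugate of [x - 1] by inversion: this is how odd
    runs of the continued fraction are subtractions too. *)
Lemma farey_up_inv x : 0 < x -> x < 1 -> farey x = (x^-1 - 1)^-1.
Proof.
move=> x0 x1; rewrite /farey ltNge (ltW x1) /=; field.
by rewrite gt_eqF //= mulN1r subr_eq0 (gt_eqF x1).
Qed.

Lemma irrational_gt1_or_lt1 x : irrational x -> (1 < x) || (x < 1).
Proof. by move=> irr; rewrite orbC -neq_lt (irrational_neq_nat 1). Qed.

Lemma farey_irrational x : 0 < x -> irrational x ->
  0 < farey x /\ irrational (farey x).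
Proof.
move=> x0 irr; case/orP: (irrational_gt1_or_lt1 irr) => x1.
  by rewrite farey_down // subr_gt0; split=> //; exact: (@irrational_subn _ 1).
rewrite farey_up_inv // invr_gt0 subr_gt0 invf_gt1 //; split=> //.
by apply/irrational_inv/(@irrational_subn _ 1)/irrational_inv.
Qed.

Lemma iter_farey_irrational x i : 0 < x -> irrational x ->
  0 < iter i farey x /\ irrational (iter i farey x).
Proof.
by move=> x0 irr; elim: i => // i [] /=; exact: farey_irrational.
Qed.

(** As long as the orbit stays above [1], it decreases by [1] at each step. *)
Lemma farey_reaches_up x : 0 < x -> irrational x ->
  exists i, iter i farey x < 1.
Proof.
move=> + irr; have := truncnS_gt x.
move: (Num.truncn x) => n; elim: n x irr => [|n IH] x irr xn x0.
  by exists 0%N.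
case/orP: (irrational_gt1_or_lt1 irr) => x1; last by exists 0%N.
have [f0 firr] := farey_irrational x0 irr.
have [|i Hi] := IH _ firr _ f0; last by exists i.+1; rewrite iterSr.
by rewrite farey_down // ltrBlDr natr1.
Qed.

(** As long as the orbit stays below [1], its inverse decreases by [1] at each
    step. *)
Lemma farey_reaches_down x : 0 < x -> irrational x ->
  exists i, 1 < iter i farey x.
Proof.
move=> + irr; have := truncnS_gt x^-1.
move: (Num.truncn x^-1) => n; elim: n x irr => [|n IH] x irr xn x0.
  by exists 0%N; move: xn; rewrite invf_lt1.
case/orP: (irrational_gt1_or_lt1 irr) => x1; first by exists 0%N.
have [f0 firr] := farey_irrational x0 irr.
have [|i Hi] := IH _ firr _ f0; last by exists i.+1; rewrite iterSr.
by rewrite farey_up_inv // invrK ltrBlDr natr1.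
Qed.

Lemma farey_turning x : 0 < x -> irrational x ->
  turning (fun i => 1 < iter i farey x).
Proof.
move=> x0 irr N; have [N0 Nirr] := iter_farey_irrational N x0 irr.
have [i1 Hi1] := farey_reaches_down N0 Nirr.
have [y0 yirr] := iter_farey_irrational i1 N0 Nirr.
have Hex : exists m, iter (m + (i1 + N)) farey x < 1.
  by have [m Hm] := farey_reaches_up y0 yirr; exists m; rewrite !iterD.
(* the last step before the orbit first drops below [1] is a turn *)
case: (ex_minnP Hex) => m Hm mmin.
case: m Hm mmin => [|m] Hm mmin.
  by rewrite add0n iterD in Hm; have := lt_trans Hi1 Hm; rewrite ltxx.
exists (m + (i1 + N))%N; split; [lia| |by rewrite -leNgt ltW].
have [_ mirr] := iter_farey_irrational (m + (i1 + N)) x0 irr.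
case/orP: (irrational_gt1_or_lt1 mirr) => // /mmin; lia.
Qed.

Lemma irrational_sub_gt1 y m : irrational y -> 0 < y ->
  (m < Num.truncn y)%N -> 1 < y - m%:R.
Proof.
move=> irr y0 my; rewrite ltrBrDr nat1r lt_neqAle eq_sym irrational_neq_nat //=.
by rewrite -truncn_ge_nat // ltW.
Qed.

Lemma iter_farey_sub y m : irrational y -> (m <= Num.truncn y)%N -> 0 < y ->
  iter m farey y = y - m%:R.
Proof.
move=> irr my y0; elim: m my => [|m IH] my; first by rewrite subr0.
rewrite iterS IH ?(ltnW my) // farey_down ?opprB -?natr1; first by ring.
exact: irrational_sub_gt1.
Qed.

Lemma iter_farey_inv y m : irrational y -> (m <= Num.truncn y)%N -> 0 < y ->
  iter m farey y^-1 = (y - m%:R)^-1.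
Proof.
move=> irr my y0; elim: m my => [|m IH] my; first by rewrite subr0.
rewrite iterS IH ?(ltnW my) //.
have ym : 1 < y - m%:R by exact: irrational_sub_gt1.
have ym0 := lt_trans ltr01 ym.
rewrite farey_up_inv ?invrK ?invr_gt0 ?invf_lt1 //.
by congr (_^-1); rewrite -natr1; ring.
Qed.

Lemma sub_truncn_bounds y : irrational y -> 0 < y ->
  0 < y - (Num.truncn y)%:R < 1.
Proof.
move=> irr y0; rewrite subr_gt0 ltrBlDr nat1r truncnS_gt andbT.
by rewrite lt_neqAle eq_sym irrational_neq_nat //= -truncn_ge_nat // ltW.
Qed.

Lemma cf_complete_irrational x j : 0 < x -> irrational x ->
  [/\ 0 < cf_complete x j, irrational (cf_complete x j) &
      (0 < j)%N -> 1 < cf_complete x j].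
Proof.
move=> x0 irr; elim: j => [|j [y0 yirr _]] //.
have /andP[t0 t1] := sub_truncn_bounds yirr y0.
split=> [||_]; rewrite /cf_complete iterS -/(cf_complete x j).
- by rewrite invr_gt0.
- exact/irrational_inv/irrational_subn.
- by rewrite invf_gt1.
Qed.

Lemma cf_sumS x j : cf_sum x j.+1 = (cf_sum x j + cf_coef x j)%N.
Proof. exact: big_ord_recr. Qed.

Lemma cf_sum_ge x j : 0 < x -> irrational x -> (j <= (cf_sum x j).+1)%N.
Proof.
move=> x0 irr; elim: j => // j IH; rewrite cf_sumS.
case: j IH => [|j] IH //.
have [y0 _ /(_ isT) y1] := cf_complete_irrational j.+1 x0 irr.
have : (1 <= cf_coef x j.+1)%N by rewrite truncn_ge_nat ltW.
lia.
Qed.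

(** [farey] never inverts, whereas the Gauss map does so after each run: the two
    orbits agree up to an inversion at the start of every other run. *)
Lemma iter_farey_cf_sum x j : 0 < x -> irrational x ->
  iter (cf_sum x j) farey x =
  if odd j then (cf_complete x j)^-1 else cf_complete x j.
Proof.
move=> x0 irr; elim: j => [|j IH]; first by rewrite /cf_sum big_ord0.
have [y0 yirr _] := cf_complete_irrational j x0 irr.
rewrite cf_sumS addnC iterD IH /=; case: (odd j) => /=.
  by rewrite iter_farey_inv.
by rewrite iter_farey_sub // invrK.
Qed.

Lemma iter_farey_run x i j : 0 < x -> irrational x ->
  (cf_sum x j <= i < cf_sum x j.+1)%N -> (1 < iter i farey x) = ~~ odd j.
Proof.
move=> x0 irr; rewrite cf_sumS => /andP[ji ij].
have [y0 yirr _] := cf_complete_irrational j x0 irr.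
have [m iE mc] : exists2 m, i = (m + cf_sum x j)%N & (m < cf_coef x j)%N.
  by exists (i - cf_sum x j)%N; lia.
have ym : 1 < cf_complete x j - m%:R by exact: irrational_sub_gt1.
rewrite iE iterD iter_farey_cf_sum //; case: (odd j).
  rewrite iter_farey_inv // ?(ltnW mc) //; apply/negbTE.
  by rewrite -leNgt invf_le1 ?(lt_trans ltr01 ym) ?ltW.
by rewrite iter_farey_sub // ?(ltnW mc).
Qed.

(** The runs cover all steps, and the side of [1] on which the orbit lies tells
    the parity of any run containing the step. *)
Lemma irr_downE x i : 0 < x -> irrational x ->
  irr_down x i = (1 < iter i farey x).
Proof.
move=> x0 irr.
have Hex : exists j, (i < cf_sum x j.+1)%N.
  by exists i.+1; have := cf_sum_ge i.+2 x0 irr; lia.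
case: (ex_minnP Hex) => j ij jmin.
have run : (cf_sum x j <= i < cf_sum x j.+1)%N.
  rewrite ij andbT; case: j ij jmin => [|j] _ jmin; first by rewrite /cf_sum big_ord0.
  by rewrite leqNgt; apply/negP => /jmin; rewrite ltnn.
apply/asboolP/idP => [[j' [j'odd run']]|].
  by rewrite (iter_farey_run x0 irr run').
by rewrite (iter_farey_run x0 irr run) => jodd; exists j.
Qed.

Lemma farey_cvg (u : nat -> R) y : y != 1 -> u @ \oo --> y ->
  farey (u n) @[n --> \oo] --> farey y.
Proof.
move=> y1 uy; have [ylt|ygt|yE] := ltgtP y 1; last by rewrite yE eqxx in y1.
- apply: (@cvg_trans _ ((fun n => u n / (1 - u n)) @ \oo)).
    apply: near_eq_cvg; near=> n.
    rewrite /farey ltNge ltW //; near: n; exact: cvgr_lt uy _ ylt.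
  rewrite /farey ltNge ltW //=; apply: cvgM => //; apply: cvgV.
    by rewrite subr_eq0 eq_sym.
  by apply: cvgB => //; exact: cvg_cst.
- apply: (@cvg_trans _ ((fun n => u n - 1) @ \oo)).
    apply: near_eq_cvg; near=> n.
    rewrite farey_down //; near: n; exact: cvgr_gt uy _ ygt.
  by rewrite farey_down //; apply: cvgB => //; exact: cvg_cst.
Unshelve. all: by end_near. Qed.

Lemma iter_farey_cvg (u : nat -> R) x i : 0 < x -> irrational x ->
  u @ \oo --> x -> iter i farey (u n) @[n --> \oo] --> iter i farey x.
Proof.
move=> x0 irr ux; elim: i => // i IH /=; apply: farey_cvg => //.
by have [_ /(irrational_neq_nat 1)] := iter_farey_irrational i x0 irr.
Qed.

(** The finitely many iterates of [x] involved stay away from [1], where the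
    branches of [farey] meet. *)
Lemma farey_steps_near (u : nat -> R) x l : 0 < x -> irrational x ->
  u @ \oo --> x ->
  \forall n \near \oo, forall i, (i <= l)%N ->
    (1 < iter i farey (u n)) = (1 < iter i farey x) /\ iter i farey (u n) != 1.
Proof.
move=> x0 irr ux.
have one_step i : \forall n \near \oo,
    (1 < iter i farey (u n)) = (1 < iter i farey x) /\ iter i farey (u n) != 1.
  have ui := @iter_farey_cvg u x i x0 irr ux.
  have [_ xirr] := iter_farey_irrational i x0 irr.
  case/orP: (irrational_gt1_or_lt1 xirr) => x1.
    near=> n; have un : 1 < iter i farey (u n) by near: n; exact: cvgr_gt ui _ x1.
    by rewrite un x1 gt_eqF.
  near=> n; have un : iter i farey (u n) < 1 by near: n; exact: cvgr_lt ui _ x1.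
  by rewrite !ltNge !ltW //= lt_eqF.
elim: l => [|l IH].
  near=> n => i; rewrite leqn0 => /eqP ->; near: n; exact: one_step.
near=> n => i; rewrite leq_eqVlt ltnS => /orP[/eqP ->|il].
  by near: n; exact: one_step.
by move: i il; near: n.
Unshelve. all: by end_near. Qed.

End Farey.

(** * The Calkin-Wilf enumeration *)

Section CalkinWilf.

Lemma fusc_double n : (0 < n)%N -> fusc n.*2 = fusc n.
Proof. by move=> n0; rewrite fusc_even ?doubleK ?odd_double //; lia. Qed.

Lemma fusc_doubleS n : (0 < n)%N -> fusc n.*2.+1 = (fusc n + fusc n.+1)%N.
Proof.
move=> n0; rewrite fusc_odd /= ?odd_double //; last by lia.
by rewrite doubleK.
Qed.

Lemma fusc_gt0 n : (0 < n)%N -> (0 < fusc n)%N.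
Proof.
elim/ltn_ind: n => n IH n0; case: (leqP n 1) => n1.
  by have -> : n = 1%N by lia.
have h0 : (0 < n./2)%N by lia.
have fh : (0 < fusc n./2)%N by apply: IH => //; lia.
rewrite -(odd_double_half n); case: (odd n) => /=.
  by rewrite fusc_doubleS // addn_gt0 fh.
by rewrite add0n fusc_double.
Qed.

(** Subtractive Euclidean algorithm on [a] and [b]: each subtraction determines
    one binary digit of [n]. *)
Lemma cw_surjective a b : (0 < a)%N -> (0 < b)%N ->
  exists2 n, (0 < n)%N & (a * fusc n.+1 = b * fusc n)%N.
Proof.
have [N] := ubnP (a + b); elim: N a b => // N IH a b abN a0 b0.
have [ab|ba|<-] := ltngtP a b; last by exists 1%N.
- have [|||n n0 E] := IH a (b - a)%N; try lia.
  exists n.*2; first by lia.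
  rewrite fusc_doubleS // fusc_double //; nia.
- have [|||n n0 E] := IH (a - b)%N b; try lia.
  exists n.*2.+1; first by lia.
  rewrite -doubleS fusc_double // fusc_doubleS //; nia.
Qed.

Lemma cw_indexP (r : rat) : 0 < r ->
  (0 < cw_index r)%N /\ r = (fusc (cw_index r))%:R / (fusc (cw_index r).+1)%:R.
Proof.
move=> r0; rewrite /cw_index; set P := [set n | _].
suff [n Pn] : exists n, P n by exact: (@getPex _ P (ex_intro _ n Pn)).
have [d d0 dE] : exists2 d : nat, (0 < d)%N & denq r = d%:Z.
  by exists `|denq r|%N; [rewrite absz_gt0 | rewrite gtz0_abs].
have [a a0 aE] : exists2 a : nat, (0 < a)%N & numq r = a%:Z.
  have nr : 0 < numq r by rewrite numq_gt0.
  by exists `|numq r|%N; [rewrite absz_gt0 gt_eqF | rewrite gtz0_abs].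
have [n n0 E] := cw_surjective a0 d0.
exists n; split=> //; rewrite -(divq_num_den r) aE dE.
apply/eqP; rewrite eqr_div ?pnatr_eq0 -?lt0n ?fusc_gt0 ?intr_eq0 -?lt0n //.
by rewrite -!natrM E mulnC.
Qed.

Context {R : realType}.

Definition cw_value (n : nat) : R := (fusc n)%:R / (fusc n.+1)%:R.

Lemma cw_value_half n : (1 < n)%N ->
  (1 < cw_value n) = odd n /\ farey (cw_value n) = cw_value n./2.
Proof.
move=> n1; have h0 : (0 < n./2)%N by lia.
have f0 : 0 < (fusc n./2)%:R :> R by rewrite ltr0n fusc_gt0.
have f1 : 0 < (fusc n./2.+1)%:R :> R by rewrite ltr0n fusc_gt0.
have fD : 0 < (fusc n./2)%:R + (fusc n./2.+1)%:R :> R by rewrite addr_gt0.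
have [E1 E2] : (1 < cw_value n) = odd n /\
   cw_value n = if odd n then cw_value n./2 + 1 else
       (fusc n./2)%:R / ((fusc n./2)%:R + (fusc n./2.+1)%:R).
  rewrite /cw_value -{1 2 4 5}(odd_double_half n); case: (odd n) => /=.
    rewrite add1n -doubleS fusc_double // fusc_doubleS // natrD.
    rewrite ltr_pdivlMr // mul1r ltrDr; split=> //.
    by field; rewrite gt_eqF.
  rewrite add0n fusc_double // fusc_doubleS // natrD ltr_pdivlMr // mul1r.
  by split=> //; apply/negbTE; rewrite -leNgt lerDl ltW.
split=> //; rewrite /farey E1 E2; case: (odd n); first by rewrite addrK.
rewrite /cw_value; field.
by rewrite !gt_eqF // addrAC subrr add0r.
Qed.

Lemma cw_value1 : cw_value 1 = 1.
Proof. by rewrite /cw_value divr1. Qed.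

(** The value at the index [1] is [1], so an orbit that has avoided [1] has not
    yet used up the binary digits of [n]. *)
Lemma iter_farey_cw n i : (0 < n)%N ->
  (forall i', (i' < i)%N -> iter i' farey (cw_value n) != 1) ->
  (0 < n %/ 2 ^ i)%N /\ iter i farey (cw_value n) = cw_value (n %/ 2 ^ i).
Proof.
move=> n0; elim: i => [|i IH] H; first by rewrite divn1.
have [|m0 E] := IH; first by move=> i' i'i; apply: H; exact: ltnW.
have m1 : (1 < n %/ 2 ^ i)%N.
  rewrite ltn_neqAle m0 andbT eq_sym; apply/eqP => m1.
  by have := H i (leqnn _); rewrite E m1 cw_value1 eqxx.
have [_ fE] := cw_value_half m1.
rewrite expnS mulnC divnMA divn2 iterS E fE; split=> //; lia.
Qed.

Definition agrees (d : nat -> bool) (l : nat) (S : finsnake) : Prop :=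
  (l.+1 < fs_size S)%N /\ forall i, (i < l)%N -> fs_down S i = d i.

(** The iterate of index [l] differs from [1], so [n] has at least [l + 2]
    binary digits. *)
Lemma rat_snake_agrees (r : rat) (d : nat -> bool) l : 0 < r ->
  (forall i, (i <= l)%N -> (1 < iter i farey (ratr r : R)) = d i /\
     iter i farey (ratr r : R) != 1) ->
  agrees d l (rat_snake r).
Proof.
move=> r0; have [n0 rE] := cw_indexP r0; rewrite /rat_snake.
move: (cw_index r) n0 rE => n n0 ->.
rewrite fmorph_div /= !ratr_nat -/(cw_value n) => H.
have Hcw i : (i <= l.+1)%N ->
    (0 < n %/ 2 ^ i)%N /\ iter i farey (cw_value n) = cw_value (n %/ 2 ^ i).
  by move=> il; apply: iter_farey_cw => // i' i'i; apply: (H i' _).2; lia.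
split=> /= [|i il].
  rewrite (gtn_eqF n0) ltnS trunc_log_max //.
  by have [] := Hcw _ (leqnn _); rewrite divn_gt0 ?expn_gt0.
have [m0 E] := Hcw i (leqW (ltnW il)).
have [<- neq1] := H i (ltnW il).
have m1 : (1 < n %/ 2 ^ i)%N.
  rewrite ltn_neqAle m0 andbT eq_sym; apply/eqP => m1.
  by move: neq1; rewrite E m1 cw_value1 eqxx.
by rewrite E (cw_value_half m1).1.
Qed.

End CalkinWilf.

(** * The measure of an infinite snake *)

Lemma cylinderE k (A : {set 'I_k.+1}) : cylinder A = word_cylinder (word A).
Proof.
apply/seteqP; split => F; rewrite /word_cylinder /= size_word => H.
  apply: (@eq_from_nth _ false); rewrite size_mkseq ?size_word // => i ik.
  by rewrite nth_mkseq // -[i]/(val (Ordinal ik)) H nth_word.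
by move=> i; rewrite -nth_word -H nth_mkseq.
Qed.

Lemma inf_filtersP d (F : cantor_space) : inf_filters d F <->
  forall n, steps_ok d 0 (mkseq F n).
Proof.
split=> [filF n i|H].
  rewrite size_mkseq => ilt; rewrite !nth_mkseq // ?(ltnW ilt) // add0n /step_ok.
  case: ifP => di; apply/implyP; apply: filF; apply: rt_step; rewrite /snake_step /=.
    by right.
  by left; rewrite di.
have {}H i : step_ok (d i) (F i) (F i.+1).
  by have := H i.+2 i; rewrite size_mkseq !nth_mkseq // => /(_ (leqnn _)).
move=> i j; elim=> {i j} [i j|//|i j l _ IH1 _ IH2]; last by move=> /IH1.
by case=> -[-> di]; [have := H i|have := H j]; rewrite /step_ok ?di ?(negbTE di) => /implyP.
Qed.

Lemma inf_filtersE d : inf_filters d = ~` \bigcup_(a : seq bool)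
   (if `[< steps_ok d 0 a >] then set0 else word_cylinder a).
Proof.
apply/seteqP; split=> F.
  move=> /inf_filtersP H [a _]; case: ifP => // /asboolP Ha Fa.
  by apply: Ha; rewrite -Fa.
move=> H; apply/inf_filtersP => n; apply: contrapT => Hn; apply: H.
by exists (mkseq F n) => //; rewrite asboolF // /word_cylinder /= size_mkseq.
Qed.

Section Limit.
Context {R : realType} (q : R) (d : nat -> bool).
Hypothesis q_gt0 : 0 < q.
Hypothesis d_turning : turning d.

Definition snake_prob (S : finsnake) (a : seq bool) : R :=
  word_prob q (fs_down S) (fs_size S) a.

Definition prefix_snake (l : nat) : finsnake := FinSnake l.+2 d.

Lemma prefix_snake_agrees l m : (l <= m)%N -> agrees d l (prefix_snake m).
Proof. by split. Qed.

Lemma snake_prob_close a e : 0 < e -> exists l, forall S S',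
  agrees d l S -> agrees d l S' -> snake_prob S a <= (1 + e) * snake_prob S' a.
Proof.
move=> e0; case: a => [|b a].
  by exists 0%N => S S' _ _; rewrite /snake_prob !word_prob_nil // mulr1 lerDl ltW.
have [l Hl] := word_prob_close q_gt0 (size a) d_turning e0.
exists l => S S' [Sl dS] [Sl' dS']; exact: Hl (ltnW Sl) (ltnW Sl') dS dS' _.
Qed.

(** Probabilities are at most [1], so the relative estimate is an absolute
    one. *)
Lemma snake_prob_cauchy a e : 0 < e -> exists l, forall S S',
  agrees d l S -> agrees d l S' -> `|snake_prob S a - snake_prob S' a| <= e.
Proof.
move=> e0; have [l Hl] := snake_prob_close a e0.
exists (maxn l (size a)) => S S' [lS dS] [lS' dS'].
have aS : agrees d l S by split=> [|i il]; [lia | apply: dS; lia].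
have aS' : agrees d l S' by split=> [|i il]; [lia | apply: dS'; lia].
have H := Hl _ _ aS aS'; have H' := Hl _ _ aS' aS.
have S1 : snake_prob S a <= 1 by apply: word_prob_le1 => //; lia.
have S1' : snake_prob S' a <= 1 by apply: word_prob_le1 => //; lia.
have S0 : 0 <= snake_prob S a by apply: word_prob_ge0.
have S0' : 0 <= snake_prob S' a by apply: word_prob_ge0.
rewrite ler_norml; apply/andP; split; nra.
Qed.

Definition limit_prob (a : seq bool) : R :=
  lim (snake_prob (prefix_snake l) a @[l --> \oo]).

Lemma prefix_snake_cvg a : snake_prob (prefix_snake l) a @[l --> \oo] --> limit_prob a.
Proof.
apply: cauchy_cvg; apply: cauchy_exP => e e0.
have e2 : 0 < e / 2 by rewrite divr_gt0.
have [l Hl] := snake_prob_cauchy a e2.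
exists (snake_prob (prefix_snake l) a), l => // m lm /=.
rewrite /ball /=; apply: le_lt_trans (Hl _ _ _ _) _; try exact: prefix_snake_agrees.
by rewrite ltr_pdivrMr // ltr_pMr // ltr1n.
Qed.

Lemma snake_prob_cvg a (S : nat -> finsnake) :
  (forall l, \forall n \near \oo, agrees d l (S n)) ->
  snake_prob (S n) a @[n --> \oo] --> limit_prob a.
Proof.
move=> aS; apply/cvgrPdist_le => e e0.
have e2 : 0 < e / 2 by rewrite divr_gt0.
have [l Hl] := snake_prob_cauchy a e2.
have /cvgrPdist_le /(_ _ e2) [m _ Hm] := @prefix_snake_cvg a.
near=> n; have aSn : agrees d l (S n) by near: n; exact: aS.
have H1 := Hl _ _ (prefix_snake_agrees (leq_maxl l m)) aSn.
have H2 := Hm _ (leq_maxr l m).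
rewrite [e]splitr; apply: le_trans (lerD H2 H1).
exact: ler_distD.
Unshelve. all: by end_near. Qed.

Lemma limit_prob_ge0 a : 0 <= limit_prob a.
Proof.
apply: limr_ge; first by apply/cvg_ex; eexists; exact: prefix_snake_cvg.
by apply: nearW => l; exact: word_prob_ge0.
Qed.

Lemma limit_prob_nil : limit_prob [::] = 1.
Proof.
apply: (cvg_unique _ (@prefix_snake_cvg _)) => //.
rewrite (_ : (fun l => _) = cst 1); first exact: cvg_cst.
by apply/funext => l; exact: word_prob_nil.
Qed.

Lemma limit_prob_rcons a :
  limit_prob a = limit_prob (rcons a true) + limit_prob (rcons a false).
Proof.
apply: (cvg_unique _ (@prefix_snake_cvg _)) => //.
have H := cvgD (@prefix_snake_cvg (rcons a true)) (@prefix_snake_cvg (rcons a false)).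
apply: (cvg_trans _ (H _)); apply: near_eq_cvg.
exists (size a) => // l /= al.
by rewrite /snake_prob word_prob_rcons //= ltnS leqW.
Qed.

Lemma limit_prob_not_ok a : ~ steps_ok d 0 a -> limit_prob a = 0.
Proof.
move=> not_ok; apply: (cvg_unique _ (@prefix_snake_cvg _)) => //.
rewrite (_ : (fun l => _) = cst 0); first exact: cvg_cst.
apply/funext => l; rewrite /snake_prob /word_prob /ext_weight big1 ?mul0r // => t _.
rewrite weightE asboolF // => ok; apply: not_ok => i ia.
by have := ok i; rewrite size_cat !nth_cat ia (ltnW ia); apply; rewrite ltn_addr.
Qed.

(** The relative estimate with ratio [2] bounds the limit below by half of the
    positive probability in a single finite snake. *)
Lemma limit_prob1_gt0 b : 0 < limit_prob [:: b].
Proof.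
have [l Hl] := snake_prob_close [:: b] (@ltr01 R).
have P0 : 0 < snake_prob (prefix_snake l) [:: b] by exact: word_prob1_gt0.
apply: (@lt_le_trans _ _ (snake_prob (prefix_snake l) [:: b] / 2)).
  by rewrite divr_gt0.
apply: limr_ge; first by apply/cvg_ex; eexists; exact: prefix_snake_cvg.
exists l => // m lm /=; rewrite ler_pdivrMr // mulrC.
exact: Hl (prefix_snake_agrees (leqnn l)) (prefix_snake_agrees lm).
Qed.

Lemma fs_prob_cvg k (A : {set 'I_k.+1}) (S : nat -> finsnake) :
  (forall l, \forall n \near \oo, agrees d l (S n)) ->
  fs_prob q (S n) (cylinder A) @[n --> \oo] --> limit_prob (word A).
Proof.
move=> aS; have H := @snake_prob_cvg (word A) S aS.
apply: (cvg_trans _ H); apply: near_eq_cvg; near=> n.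
have [kS _] : agrees d k (S n) by near: n; exact: aS.
by rewrite fs_probE // ltnW.
Unshelve. all: by end_near. Qed.

Lemma approximates_agrees S : approximates S d ->
  forall l, \forall n \near \oo, agrees d l (S n).
Proof.
move=> aS l; exists l => // n /= ln; have [nS dS] := aS n.
by split=> [|i il]; [lia | apply: dS; lia].
Qed.

(** The complement of the set of filters is the union of the cylinders of the
    words violating some step: countably many null sets. *)
Lemma snake_measure_exists : exists mu : probability borel_cantor R,
  is_snake_measure q d mu.
Proof.
have [mu muE] :=
  cantor_extension limit_prob_ge0 limit_prob_nil limit_prob_rcons.
exists mu; split; last first.
  move=> k A _ S /approximates_agrees aS.
  have -> : mu (cylinder A) = (limit_prob (word A))%:E by rewrite cylinderE muE.
  exact: fs_prob_cvg.
pose N (a : seq bool) : set borel_cantor :=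
  if `[< steps_ok d 0 a >] then set0 else word_cylinder a.
have mN a : measurable (N a).
  by rewrite /N; case: ifP => // _; exact: measurable_word_cylinder.
have N0 a : mu (N a) = 0%E.
  by rewrite /N; case: asboolP => [_|/limit_prob_not_ok a0]; rewrite ?measure0 // muE a0.
have mU : measurable (\bigcup_a N a).
  by apply: countable_bigcupT_measurable => //; exact: countableP.
rewrite inf_filtersE probability_setC // -/N.
suff -> : mu (\bigcup_a N a) = 0%E by rewrite sube0.
apply/(measure_negligible mU).
rewrite (_ : \bigcup_a N a = \bigcup_n oapp N set0 (unpickle n : option (seq bool))).
  apply: negligible_bigcup => n; case: unpickle => [a|] /=; last exact: negligible_set0.
  by apply/negligibleP => //; exact: N0.
apply/seteqP; split=> F [i _ Fi]; first by exists (pickle i) => //; rewrite pickleK.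
by case: unpickle Fi => // a Fa; exists a.
Qed.

Lemma snake_measure_cylinder (mu : probability borel_cantor R) k
    (A : {set 'I_k.+1}) : is_snake_measure q d mu -> is_prefix_filter d A ->
  fine (mu (cylinder A)) = limit_prob (word A).
Proof.
move=> [_ muP] Afil.
have aS : approximates prefix_snake d by move=> l; split.
apply: (cvg_unique _ (muP _ _ Afil _ aS)) => //.
exact: fs_prob_cvg (approximates_agrees aS).
Qed.

End Limit.

(** * Convergence along rational approximations *)

Lemma prefix_filter0 d (A : {set 'I_1}) : is_prefix_filter d A.
Proof. by move=> i j _; rewrite !ord1. Qed.

Lemma contains0E : contains0 = cylinder [set: 'I_1]%SET.
Proof.
apply/seteqP; split=> F /=; first by move=> F0 i; rewrite ord1 inE.
by move=> /(_ ord0); rewrite inE.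
Qed.

Lemma not_contains0E : ~` contains0 = cylinder (@finset.set0 'I_1).
Proof.
apply/seteqP; split=> F /=; first by move=> F0 i; rewrite ord1 inE; apply/negP.
by move=> /(_ ord0); rewrite inE /contains0 /= => ->.
Qed.

Theorem theorem4p10 (R : realType) (x q : R) (r : nat -> rat)
    (x_gt0 : 0 < x) (x_irr : irrational x) (q_gt0 : 0 < q)
    (r_gt0 : forall n, 0 < r n)
    (r_cvg : (fun n => ratr (r n) : R) @ \oo --> x) :
  (forall (k : nat) (A : {set 'I_k.+1}), is_prefix_filter (irr_down x) A ->
     (fun n => rat_prob (r n) q (cylinder A)) @ \oo
       --> irr_prob x q (cylinder A)) /\
  (fun n => q_rat (r n) q) @ \oo --> q_irr x q.
Proof.
have downE : irr_down x = fun i => 1 < iter i farey x.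
  by apply/funext => i; exact: irr_downE.
have turn : turning (irr_down x) by rewrite downE; exact: farey_turning.
have agree l : \forall n \near \oo, agrees (irr_down x) l (rat_snake (r n)).
  near=> n; apply: (@rat_snake_agrees R) => // i il; rewrite downE.
  by move: i il; near: n; exact: farey_steps_near.
have measP : is_snake_measure q (irr_down x) (irr_measure x q).
  have [mu muP] := snake_measure_exists q_gt0 turn.
  exact: (@getPex _ [set mu | is_snake_measure q (irr_down x) mu] (ex_intro _ mu muP)).
have irrE k (A : {set 'I_k.+1}) : is_prefix_filter (irr_down x) A ->
    irr_prob x q (cylinder A) = limit_prob q (irr_down x) (word A).
  exact: snake_measure_cylinder.
have cyl k (A : {set 'I_k.+1}) : is_prefix_filter (irr_down x) A ->
    (fun n => rat_prob (r n) q (cylinder A)) @ \oo --> irr_prob x q (cylinder A).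
  by move=> Afil; rewrite irrE //; exact: fs_prob_cvg.
split=> //; rewrite /q_irr /q_rat not_contains0E contains0E.
apply: cvgM; first exact/cyl/prefix_filter0.
apply: cvgV; last exact/cyl/prefix_filter0.
rewrite irrE; last exact: prefix_filter0.
have -> : word (@finset.set0 'I_1) = [:: false].
  by rewrite /word enum_ordSl enum_ord0 /= inE.
by rewrite gt_eqF // limit_prob1_gt0.
Unshelve. all: by end_near. Qed.
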